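(* Let $d\ge1$ and let $K:\mathbb{R}_*^d\times\mathbb{R}_*^d\to[0,\infty)$ be continuous and symmetric, $K(x,y)=K(y,x)$. Suppose that there are $c_2\in(0,\infty)$, $\beta\in\mathbb{R}$ and $\gamma=(\gamma_1,\gamma_2),\lambda=(\lambda_1,\lambda_2)\in\mathbb{R}^2$ with $-\lambda_j\le\gamma_j+\lambda_j$ and $\gamma_j+\lambda_j\le1$ for $j=1,2$, such that for all $x,y\in\mathbb{R}_*^d$ with $|y|\le|x|$, $$K(x,y)\le c_2\begin{cases}|x|^{-\beta}|y|^{-\beta}, & |x|,|y|\le1,\\ |x|^{\gamma_1+\lambda_1}|y|^{-\lambda_1}, & |x|\ge1,\ |y|\le1,\\ |x|^{\gamma_2+\lambda_2}|y|^{-\lambda_2}, & |x|,|y|\ge1.\end{cases}$$ Suppose that $f_0\in\mathcal{M}_+(\mathbb{R}_*^d)$ satisfies $\int_{\mathbb{R}_*^d}|x|f_0(dx)+\int_{\mathbb{R}_*^d}\omega(x)f_0(dx)<\infty$, and let $f:[0,\infty)\to\mathcal{M}_+(\mathbb{R}_*^d)$ be any weak solution to the coagulation equation with kernel $K$ and initial data $f_0$. If $\gamma_2\le1$, then $$\int_{\mathbb{R}_*^d}x f(dx,t)=\int_{\mathbb{R}_*^d}x f_0(dx)\qquad\text{for all }t\ge0.$$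
   Context: $\mathbb{R}_*^d=[0,\infty)^d\setminus\{0\}$ and $|x|=\sum_{j=1}^d|x_j|$. $\mathcal{M}_+(\mathbb{R}_*^d)$ is the set of positive Radon measures on $\mathbb{R}_*^d$; $\mathcal{M}_b(\mathbb{R}_*^d)$ is the space of signed bounded Radon measures, identified with the dual of $C_0(\mathbb{R}_*^d)$, the sup-norm closure of $C_c(\mathbb{R}_*^d)$. For a continuous $\omega\ge0$ and a measure $\mu$, $\omega\mu$ is the weighted measure $\omega(x)\mu(dx)$; $(\omega f)(\cdot,t)=\omega f(\cdot,t)$. For vectors, $a\le b$ means componentwise inequality. Weight: $\omega(x)=|x|^{\min(-\beta,-\lambda_1)}$ if $|x|\le1$, and $\omega(x)=|x|^{\max(\gamma_1+\lambda_1,\gamma_2+\lambda_2)}$ if $|x|>1$. Test functions: $C^1([0,\infty);C_c(\mathbb{R}_*^d))$ denotes the set of functions $\varphi:\mathbb{R}_*^d\times[0,\infty)\to\mathbb{R}$ such that for each fixed $x\in\mathbb{R}_*^d$ the function $\varphi(x,\cdot)$ is continuously differentiable, and $\varphi(\cdot,t)\in C_c(\mathbb{R}_*^d)$ for all $t\in[0,\infty)$. Weak solution: Let $f_0\in\mathcal{M}_+(\mathbb{R}_*^d)$ with $\int|x|f_0(dx)+\int\omega(x)f_0(dx)<\infty$. A map $f:[0,\infty)\to\mathcal{M}_+(\mathbb{R}_*^d)$ is a weak solution with initial data $f_0$ if: (a) $f(\cdot,0)=f_0$; (b) $\omega f\in C([0,\infty);\mathcal{M}_b(\mathbb{R}_*^d))$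 with $\mathcal{M}_b(\mathbb{R}_*^d)$ endowed with the weak*-topology; (c) $\sup_{s\in[0,t]}\int_{\mathbb{R}_*^d}\omega(x)f(dx,s)<\infty$ for all $t\ge0$; (d) $\int_{\mathbb{R}_*^d}x f(dx,t)\le\int_{\mathbb{R}_*^d}x f_0(dx)$ (componentwise) for all $t\ge0$; (e) for all $t\ge0$ and all $\varphi\in C^1([0,\infty);C_c(\mathbb{R}_*^d))$, $$\int\varphi(x,t)f(dx,t)-\int\varphi(x,0)f_0(dx)=\int_0^t\int f(dx,s)\partial_s\varphi(x,s)\,ds+\frac12\int_0^t\iint K(x,y)f(dx,s)f(dy,s)\left[\varphi(x+y,s)-\varphi(x,s)-\varphi(y,s)\right]ds,$$ all integrals being over $\mathbb{R}_*^d$. *)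

(* Defs.v *)
From HB Require Import structures.
From mathcomp Require Import all_boot all_order all_algebra.
From mathcomp Require Import all_classical all_reals all_analysis.
Set Implicit Arguments.
Unset Strict Implicit.
Unset Printing Implicit Defensive.
Import Order.TTheory GRing.Theory Num.Theory.
Import numFieldNormedType.Exports.
Local Open Scope classical_set_scope.
Local Open Scope ring_scope.

Definition orthant (R : realType) (d : nat) : set 'rV[R]_d :=
  [set x : 'rV[R]_d | (forall j, 0 <= x ord0 j) /\ x != 0].
Arguments orthant : clear implicits.

(* [0, oo)^d \ {0} as a space in its own right: compactness, C_c and Radon
   measures are relative to it, so that 0 is at infinity. *)
Definition Rstar (R : realType) (d : nat) : Type := orthant R d.

HB.instance Definition _ (R : realType) (d : nat) :=
  PseudoMetric.copy (Rstar R d) (set_type (orthant R d)).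

Definition vec {R : realType} {d : nat} (x : Rstar R d) : 'rV[R]_d :=
  set_val x.

Lemma orthant_add (R : realType) (d : nat) (x y : Rstar R d) :
  vec x + vec y \in orthant R d.
Proof.
have [x_ge0 x_neq0] : orthant R d (vec x) := set_mem (valP x).
have [y_ge0 _] : orthant R d (vec y) := set_mem (valP y).
apply/mem_set; split=> [j|]; first by rewrite mxE addr_ge0.
apply: contra x_neq0 => /eqP xy0; apply/eqP/rowP => j.
have /eqP := congr1 (fun v : 'rV[R]_d => v ord0 j) xy0; rewrite !mxE.
by rewrite (paddr_eq0 (x_ge0 j) (y_ge0 j)) => /andP[/eqP].
Qed.

Definition addRstar {R : realType} {d : nat} (x y : Rstar R d) : Rstar R d :=
  exist _ (vec x + vec y) (orthant_add x y).

(* Measurable types are pointed, so the dimension has to be positive. *)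
Lemma orthant_ones (R : realType) (n : nat) :
  (const_mx 1 : 'rV[R]_n.+1) \in orthant R n.+1.
Proof.
apply/mem_set; split=> [j|]; first by rewrite mxE.
by apply/eqP => /rowP/(_ ord0)/eqP; rewrite !mxE oner_eq0.
Qed.

HB.instance Definition _ (R : realType) (n : nat) :=
  isPointed.Build (Rstar R n.+1) (exist _ (const_mx 1) (orthant_ones R n)).

HB.instance Definition _ (R : realType) (n : nat) :=
  @isMeasurable.Build (sigma_display (@open (Rstar R n.+1))) (Rstar R n.+1)
    <<s @open (Rstar R n.+1) >> (@sigma_algebra0 _ setT _) (@sigma_algebraC _ _)
    (@sigma_algebra_bigcup _ setT _).

Definition norm1 {R : realType} {d : nat} (x : Rstar R d) : R :=
  \sum_j `|vec x ord0 j|.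

Definition weight {R : realType} {d : nat} (beta : R) (gamma lambda : R * R)
    (x : Rstar R d) : R :=
  if norm1 x <= 1 then norm1 x `^ Num.min (- beta) (- lambda.1)
  else norm1 x `^ Num.max (gamma.1 + lambda.1) (gamma.2 + lambda.2).

Definition kernel_bound {R : realType} {d : nat}
    (K : Rstar R d -> Rstar R d -> R) (c2 beta : R) (gamma lambda : R * R) :=
  forall x y, norm1 y <= norm1 x ->
    [/\ norm1 x <= 1 -> norm1 y <= 1 ->
          K x y <= c2 * (norm1 x `^ (- beta) * norm1 y `^ (- beta)),
        1 <= norm1 x -> norm1 y <= 1 ->
          K x y <= c2 * (norm1 x `^ (gamma.1 + lambda.1)
                         * norm1 y `^ (- lambda.1))
      & 1 <= norm1 x -> 1 <= norm1 y ->
          K x y <= c2 * (norm1 x `^ (gamma.2 + lambda.2)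
                         * norm1 y `^ (- lambda.2))].

Section measures.
Context {R : realType} {n : nat}.
Local Notation E := (Rstar R n.+1).

Definition radon (mu : {measure set E -> \bar R}) :=
  (forall C : set E, compact C -> (mu C < +oo)%E) /\
  (forall A : set E, measurable A ->
     mu A = ereal_sup [set mu C | C in [set C | compact C /\ C `<=` A]]).

Definition moment (mu : {measure set E -> \bar R}) : 'rV[\bar R]_n.+1 :=
  \row_j (\int[mu]_x (vec x ord0 j)%:E)%E.

Definition Cc : set (E -> R) :=
  [set psi | continuous psi /\ compact (closure [set x | psi x != 0])].

Definition C0 : set (E -> R) := closure (Cc : set {uniform E -> R}).

(* Continuity of t |-> w f(., t) from [0, oo) to the signed bounded Radon
   measures with the weak-* topology of the dual of C0: the measures w f(., t)
   are bounded, and their pairings with the elements of C0 are continuous. *)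
Definition weakstar_continuous (w : E -> R)
    (f : R -> {measure set E -> \bar R}) :=
  (forall t : R, 0 <= t -> (\int[f t]_x (w x)%:E < +oo)%E) /\
  (forall psi, C0 psi ->
     {within `[0, +oo[, continuous
        (fun t => \int[f t]_x (psi x * w x) : R)}).

(* Functions R -> R stand for functions on [0, oo): the difference quotient at s
   is restricted to s + h >= 0, which gives a one-sided derivative at 0. *)
Definition quot (g : R -> R) (s : R) : R -> R :=
  fun h => h^-1 * (g (s + h) - g s).

Definition dquot_filter (s : R) := within [set h : R | 0 <= s + h] 0^'.

Definition deriv0 (g : R -> R) (s : R) : R :=
  lim (quot g s @ dquot_filter s).

Definition C1 (g : R -> R) :=
  (forall s : R, 0 <= s -> cvg (quot g s @ dquot_filter s)) /\
  {within `[0, +oo[, continuous (deriv0 g)}.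

Definition test_function (phi : E -> R -> R) :=
  (forall x, C1 (phi x)) /\ (forall t : R, 0 <= t -> Cc (phi ^~ t)).

Definition coag (phi : E -> R -> R) (s : R) (x y : E) : R :=
  phi (addRstar x y) s - phi x s - phi y s.

(* Test functions are only regular separately in x and in t, so the time
   integrals of the weak formulation can diverge (e.g. for a sum of bumps
   accumulating at some (x, t)); the identity is required of those for which
   they converge absolutely, as otherwise it is meaningless. *)
Definition weak_integrable (K : E -> E -> R) (f : R -> {measure set E -> \bar R})
    (phi : E -> R -> R) (t : R) :=
  (\int[lebesgue_measure]_(s in `[0%R, t])
     \int[f s]_x (`|deriv0 (phi x) s|)%R%:E < +oo)%E /\
  (\int[lebesgue_measure]_(s in `[0%R, t])
     \int[f s]_x \int[f s]_y (`|K x y * coag phi s x y|)%R%:E < +oo)%E.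

Definition weak_identity (K : E -> E -> R) (f0 : {measure set E -> \bar R})
    (f : R -> {measure set E -> \bar R}) (phi : E -> R -> R) (t : R) :=
  \int[f t]_x phi x t - \int[f0]_x phi x 0 =
    \int[lebesgue_measure]_(s in `[0, t]) \int[f s]_x deriv0 (phi x) s
    + 2^-1 * \int[lebesgue_measure]_(s in `[0, t])
               \int[f s]_x \int[f s]_y (K x y * coag phi s x y).

(* Only the values of f on [0, oo) matter. *)
Record weak_solution (K : E -> E -> R) (w : E -> R)
    (f0 : {measure set E -> \bar R}) (f : R -> {measure set E -> \bar R})
    : Prop := WeakSolution {
  _ : forall t : R, 0 <= t -> radon (f t);
  _ : forall A, measurable A -> f 0 A = f0 A;
  _ : weakstar_continuous w f;
  _ : forall t : R, 0 <= t ->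
        (ereal_sup [set \int[f s]_x (w x)%:E | s in `[0%R, t]] < +oo)%E;
  _ : forall t : R, 0 <= t ->
        forall j, (moment (f t) ord0 j <= moment f0 ord0 j)%E;
  _ : forall (t : R) phi, 0 <= t -> test_function phi ->
        weak_integrable K f phi t -> weak_identity K f0 f phi t
}.

End measures.

(* Main.v *)
Require Import Defs.
From HB Require Import structures.
From mathcomp Require Import all_boot all_order all_algebra.
From mathcomp Require Import all_classical all_reals all_analysis.
From mathcomp Require Import ring lra.
From mathcomp Require Import measurable_realfun.
Set Implicit Arguments.
Unset Strict Implicit.
Unset Printing Implicit Defensive.
Import Order.TTheory GRing.Theory Num.Theory.
Import numFieldNormedType.Exports.
Local Open Scope classical_set_scope.
Local Open Scope ring_scope.

(** Let phi be a coordinate x_j multiplied by a cutoff that is 1 for |x| between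
    1/p and p, up to constants, and vanishes near 0 and near infinity. Since
    x_j is additive, phi(x + y) - phi(x) - phi(y) tends to 0 as p grows, so the
    weak formulation yields conservation of the j-th moment as soon as the
    collision term may be passed to the limit.

    The slope of the cutoff is at most of order 1/|x|, so that
    |phi(x + y) - phi(x) - phi(y)| <= 5 min(|x|, |y|) uniformly in p
    ([coag_cut_coord_le]). With this factor the kernel satisfies
    K(x, y) min(|x|, |y|) <= c2 W(x) W(y), where W(x) = w(x) + |x| and w is the
    weight ([kernel_mul_norm1_le]). Only the case |x|, |y| >= 1 needs more than
    the definition of w: there, for |y| <= |x|, the left-hand side is at most
    c2 |x|^(gamma2 + lambda2) |y|^(1 - lambda2) <= c2 |x| |y|, because both
    gamma2 + lambda2 and gamma2 are at most 1.

    The increment is 0 when x and y both lie in the region where a cutoff chi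
    at a fixed fraction of p is positive. Hence
    K |phi(x + y) - phi(x) - phi(y)| is at most
    5 c2 W(x) W(y) [(1 - chi(x)) + (1 - chi(y))]
    ([kernel_coag_le]), and its double integral against f(., s) is at most
    10 c2 times the integral of W times h_p(s), where h_p(s) is the integral of
    W (1 - chi) against f(., s) ([double_integral_le]). The integral of W is
    bounded on [0, t] by the a priori bounds on a weak solution. By dominated
    convergence h_p(s) tends to 0 for each s ([defect_cvg0]); it is measurable
    in s, because W chi / w is an admissible function for the weak-* continuity
    of w f ([defect_measurable]). Dominated convergence on [0, t] finishes the
    proof. *)

(** * Cutoffs on the half-line *)

Section cutoff.
Context {R : realType}.
Implicit Types p r h a b : R.

Definition clip r : R := Num.max 0 (Num.min 1 r).

Lemma clip_ge0 r : 0 <= clip r.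
Proof. by rewrite /clip le_max lexx. Qed.

Lemma clip_le1 r : clip r <= 1.
Proof. by rewrite /clip ge_max ler01 ge_min lexx. Qed.

Lemma clip_eq0 r : r <= 0 -> clip r = 0.
Proof.
by move=> r0; rewrite /clip min_r ?(le_trans r0)// max_l.
Qed.

Lemma clip_eq1 r : 1 <= r -> clip r = 1.
Proof. by move=> r1; rewrite /clip min_l// max_r. Qed.

(** Clipping is the metric projection onto [0, 1]. *)
Lemma clip_lip a b : `|clip a - clip b| <= `|a - b|.
Proof.
wlog ab : a b / a <= b.
  move=> H; have [/H//|/ltW/H] := leP a b.
  by rewrite distrC [leRHS]distrC.
rewrite distrC [leRHS]distrC [leRHS]ger0_norm ?subr_ge0//.
rewrite ler_norml /clip /Num.max /Num.min.
by do ![case: ifP => /=]; rewrite ?ltNge => *; apply/andP; split; lra.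
Qed.

(** The first factor removes the neighbourhood of 0, which is at infinity in
    the orthant without its origin; the second one removes large sizes. *)
Definition cutoff p r : R := clip (p * r - 1) * clip (2 - r / p).

Lemma cutoff_ge0 p r : 0 <= cutoff p r.
Proof. by rewrite mulr_ge0 ?clip_ge0. Qed.

Lemma cutoff_le1 p r : cutoff p r <= 1.
Proof. by rewrite mulr_ile1 ?clip_ge0 ?clip_le1. Qed.

Lemma cutoff_supp p r : 0 < p -> cutoff p r != 0 -> p^-1 <= r <= 2 * p.
Proof.
move=> p0; apply: contraR; rewrite negb_and -!ltNge => /orP[rp|rp].
- rewrite /cutoff clip_eq0 ?mul0r// subr_le0 -ler_pdivlMl// mulr1.
  exact: ltW.
- rewrite /cutoff [clip (2 - _)]clip_eq0 ?mulr0// subr_le0.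
  by rewrite ler_pdivlMr// ltW.
Qed.

Lemma cutoff_eq1 p r : 0 < p -> 2 / p <= r <= p -> cutoff p r = 1.
Proof.
move=> p0 /andP[r1 r2]; rewrite /cutoff !clip_eq1 ?mulr1//.
  by have : r / p <= 1; [rewrite ler_pdivrMr// mul1r|lra].
by move: r1; rewrite ler_pdivrMr// => r1; lra.
Qed.

(** The two factors have slope p for r <= 2/p and 1/p for r <= 2p, and are
    constant beyond: in both cases the slope is at most 2/r. The bound is
    therefore uniform in p. *)
Lemma cutoff_increment p r h : 0 < p -> 0 <= r -> 0 <= h ->
  r * `|cutoff p (r + h) - cutoff p r| <= 4 * h.
Proof.
move=> p0 r0 h0; have rp0 : 0 <= r / p by rewrite divr_ge0// ltW.
have up : r * `|clip (p * (r + h) - 1) - clip (p * r - 1)| <= 2 * h.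
  have [pr2|pr2] := leP 2 (p * r).
    rewrite !clip_eq1 ?subrr ?normr0 ?mulr0 ?mulr_ge0//; first by lra.
    by rewrite mulrDr; have := mulr_ge0 (ltW p0) h0; lra.
  apply: (@le_trans _ _ (r * (p * h))); last first.
    by rewrite mulrA [r * p]mulrC ler_wpM2r// ltW.
  rewrite ler_wpM2l//; apply: (le_trans (clip_lip _ _)).
  by rewrite ger0_norm; have := mulr_ge0 (ltW p0) h0; nra.
have down : r * `|clip (2 - (r + h) / p) - clip (2 - r / p)| <= 2 * h.
  have hp0 : 0 <= h / p by rewrite divr_ge0// ltW.
  have [pr2|pr2] := leP 2 (r / p).
    rewrite !clip_eq0 ?subrr ?normr0 ?mulr0 ?mulr_ge0//; first by lra.
    by rewrite mulrDl; lra.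
  apply: (@le_trans _ _ (r * (h / p))); last first.
    by rewrite mulrCA mulrC ler_wpM2r// ltW.
  rewrite ler_wpM2l//; apply: (le_trans (clip_lip _ _)).
  by rewrite ler_norml mulrDl; apply/andP; split; lra.
rewrite /cutoff; move: up down.
move: (clip_ge0 (p * (r + h) - 1)) (clip_le1 (p * (r + h) - 1)).
move: (clip_ge0 (2 - r / p)) (clip_le1 (2 - r / p)).
move: (clip (p * (r + h) - 1)) (clip (p * r - 1)) => a a'.
move: (clip (2 - (r + h) / p)) (clip (2 - r / p)) => b' b b0 b1 a0 a1 up down.
have -> : a * b' - a' * b = a * (b' - b) + (a - a') * b by ring.
apply: (@le_trans _ _ (r * (`|b' - b| + `|a - a'|))); last by lra.
rewrite ler_wpM2l//; apply: (le_trans (ler_normD _ _)); rewrite !normrM.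
by rewrite lerD// ?(ger0_norm a0) ?(ger0_norm b0) ?ler_piMl ?ler_piMr.
Qed.

Lemma clip_continuous : continuous clip.
Proof.
move=> r; apply: (@continuous_max R R (cst 0) (Num.min 1)).
  exact: cvg_cst.
by apply: (@continuous_min R R (cst 1) id); [exact: cvg_cst|exact: cvg_id].
Qed.

Lemma cutoff_continuous p : continuous (cutoff p).
Proof.
move=> r; apply: (@continuousM R R (fun r => clip (p * r - 1))
  (fun r => clip (2 - r / p))); apply: continuous_comp;
  try exact: clip_continuous.
- apply: cvgB; last exact: cvg_cst.
  by apply: cvgM; [exact: cvg_cst|exact: cvg_id].
- apply: cvgB; first exact: cvg_cst.
  by apply: cvgM; [exact: cvg_id|exact: cvg_cst].
Qed.

End cutoff.

(** * Estimates of iterated integrals *)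

Section lower_integral.
Local Open Scope ereal_scope.
Context d (T : measurableType d) (R : realType).
Context (mu : {measure set T -> \bar R}).
Implicit Types (D : set T).

(** The integral of a nonnegative function is a supremum over the simple
    functions below it, so a pointwise comparison is enough. This gives bounds
    on iterated integrals of K(x, y) [phi(x + y) - phi(x) - phi(y)] in which
    the inner integral is any function of the outer variable. *)
Lemma ge0_le_integral_nonmeas D (f g : T -> \bar R) :
  (forall x, D x -> 0 <= f x) -> (forall x, D x -> f x <= g x) ->
  \int[mu]_(x in D) f x <= \int[mu]_(x in D) g x.
Proof.
move=> f0 fg; rewrite !ge0_integralE//; last first.
  by move=> x Dx; rewrite (le_trans (f0 x Dx))// fg.
apply: ereal_sup_le => _ [h hf <-]; exists h => // x.
apply: (le_trans (hf x)); rewrite /patch; case: ifPn => //.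
by rewrite inE => /fg.
Qed.

(** The integrals of the positive and of the negative part both lie between 0
    and the integral of g, hence so does the absolute value of their
    difference. *)
Lemma abse_integral_le D (f g : T -> \bar R) :
  (forall x, D x -> `|f x| <= g x) ->
  `|\int[mu]_(x in D) f x| <= \int[mu]_(x in D) g x.
Proof.
move=> fg.
have pos : \int[mu]_(x in D) f^\+ x <= \int[mu]_(x in D) g x.
  apply: ge0_le_integral_nonmeas => x Dx; first exact: funepos_ge0.
  apply: le_trans (fg x Dx); rewrite funeposE ge_max abse_ge0 andbT.
  exact: lee_abs.
have neg : \int[mu]_(x in D) f^\- x <= \int[mu]_(x in D) g x.
  apply: ge0_le_integral_nonmeas => x Dx; first exact: funeneg_ge0.
  apply: le_trans (fg x Dx); rewrite funenegE ge_max abse_ge0 andbT.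
  by rewrite -abseN lee_abs.
rewrite integralE; set a := (X in `|X - _|); set b := (X in `|_ - X|).
have a0 : 0 <= a by exact: integral_ge0.
have b0 : 0 <= b by exact: integral_ge0.
have [ab|/ltW ab] := leP 0 (a - b).
  by rewrite gee0_abs// -[leRHS]sube0 leeB.
by rewrite lee0_abs// leeNl -[leLHS]add0e leeB.
Qed.

Lemma normr_Rintegral_le D (f g : T -> R) :
  (forall x, D x -> (`|f x| <= g x)%R) ->
  \int[mu]_(x in D) (g x)%:E < +oo ->
  (`|\int[mu]_(x in D) f x| <= \int[mu]_(x in D) g x)%R.
Proof.
move=> fg goo.
have g0 x : D x -> (0 <= g x)%R by move=> /fg; exact: le_trans.
have gfin : \int[mu]_(x in D) (g x)%:E \is a fin_num.
  by rewrite ge0_fin_numE// integral_ge0.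
have := @abse_integral_le D (EFin \o f) (EFin \o g) fg.
rewrite /Rintegral => le_fg.
have ffin : \int[mu]_(x in D) (f x)%:E \is a fin_num.
  by rewrite fin_num_abs; exact: le_lt_trans goo.
by rewrite -lee_fin -abse_EFin !fineK.
Qed.

End lower_integral.

Section integrals.
Context d (T : measurableType d) (R : realType).
Context (mu : {measure set T -> \bar R}).
Implicit Types (D : set T) (g h u : T -> R).

Lemma EFin_Rintegral D g : measurable D -> mu.-integrable D (EFin \o g) ->
  (\int[mu]_(x in D) g x)%:E = (\int[mu]_(x in D) (g x)%:E)%E.
Proof. by move=> mD ig; rewrite fineK//; exact: integrable_fin_num. Qed.

Lemma cvg_Rintegral D (u_ : nat -> T -> R) u g : measurable D ->
  (forall m, measurable_fun D (u_ m)) ->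
  (forall x, D x -> u_ ^~ x @ \oo --> u x) ->
  mu.-integrable D (EFin \o g) ->
  (forall m x, D x -> `|u_ m x| <= g x) ->
  (fun m => \int[mu]_(x in D) u_ m x) @ \oo --> \int[mu]_(x in D) u x.
Proof.
move=> mD mu_ u_u ig u_g.
have [] := @dominated_convergence _ _ _ mu D mD (fun m => EFin \o u_ m)
  (EFin \o u) (EFin \o g).
- by move=> m; exact/measurable_EFinP.
- exact/measurable_EFinP/(measurable_fun_cvg mu_ u_u).
- by apply: aeW => x /= Dx; apply: cvg_EFin; [exact: nearW|exact: u_u].
- exact: ig.
- by apply: aeW => x m Dx /=; rewrite lee_fin u_g.
move=> iu _ lim_u; apply: fine_cvg.
by rewrite EFin_Rintegral.
Qed.

(** The majorant is a sum of two products of a function of x and a function of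
    y, so its iterated integrals are computed by linearity alone. *)
Lemma double_integral_le (F : T -> T -> R) (k : R) g h : 0 <= k ->
  (forall x, 0 <= g x) -> (forall x, 0 <= h x) ->
  mu.-integrable setT (EFin \o g) ->
  mu.-integrable setT (EFin \o (fun x => g x * h x)) ->
  (forall x y, `|F x y| <= k * (g x * g y) * (h x + h y)) ->
  let B := 2 * k * (\int[mu]_x g x) * (\int[mu]_x (g x * h x)) in
  (\int[mu]_x \int[mu]_y (`|F x y|)%:E <= B%:E)%E /\
  `|\int[mu]_x \int[mu]_y F x y| <= B.
Proof.
move=> k0 g0 h0 ig igh F_le B.
set G := \int[mu]_x g x in B *; set H := \int[mu]_x (g x * h x) in B *.
have iZ (c : R) u : mu.-integrable setT (EFin \o u) ->
    mu.-integrable setT (EFin \o (fun y => c * u y)).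
  move=> iu; have := integrableZl measurableT c iu.
  by apply: eq_integrable => // x _ /=; rewrite EFinM.
have iD u v : mu.-integrable setT (EFin \o u) ->
    mu.-integrable setT (EFin \o v) ->
    mu.-integrable setT (EFin \o (fun y => u y + v y)).
  by move=> iu iv; have := integrableD measurableT iu iv.
have Fy x : (\int[mu]_y (k * (g x * g y) * (h x + h y))%:E)%E =
    (k * h x * G * g x + k * H * g x)%:E.
  have -> : (fun y => (k * (g x * g y) * (h x + h y))%:E) =
      EFin \o (fun y => k * g x * h x * g y + k * g x * (g y * h y)).
    by apply/funext => y /=; congr EFin; ring.
  rewrite -EFin_Rintegral//; last by apply: iD; exact: iZ.
  rewrite RintegralD//; [|exact: iZ|exact: iZ].
  by rewrite !RintegralZl// -/G -/H; congr EFin; ring.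
have iout : mu.-integrable setT
    (EFin \o (fun x => k * h x * G * g x + k * H * g x)).
  have -> : (fun x => k * h x * G * g x + k * H * g x) =
      (fun x => k * G * (g x * h x) + k * H * g x).
    by apply/funext => x; ring.
  by apply: iD; exact: iZ.
have FxE : \int[mu]_x (k * h x * G * g x + k * H * g x) = B.
  have -> : (fun x => k * h x * G * g x + k * H * g x) =
      (fun x => k * G * (g x * h x) + k * H * g x).
    by apply/funext => x; ring.
  rewrite RintegralD//; [|exact: iZ|exact: iZ].
  by rewrite !RintegralZl// -/G -/H /B; ring.
split.
  rewrite -FxE EFin_Rintegral//; apply: ge0_le_integral_nonmeas => x _.
    by apply: integral_ge0 => y _; rewrite lee_fin.
  rewrite -Fy; apply: ge0_le_integral_nonmeas => y _; rewrite lee_fin//.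
rewrite -FxE; apply: normr_Rintegral_le => [x _|]; last first.
  by rewrite -EFin_Rintegral// ltry.
rewrite (_ : k * h x * G * g x + k * H * g x =
    fine (\int[mu]_y (k * (g x * g y) * (h x + h y))%:E)%E); last by rewrite Fy.
by apply: normr_Rintegral_le => [y _|]; rewrite ?Fy ?ltry.
Qed.

End integrals.

(** * The orthant without its origin *)

Section space.
Context {R : realType} {d : nat}.
Local Notation E := (Rstar R d).
Implicit Types x y : E.

Lemma vec_continuous : continuous (@vec R d).
Proof. exact: initial_continuous. Qed.

Lemma vec_coord_continuous j : continuous (fun x => vec x ord0 j).
Proof.
move=> x; apply: (@continuous_comp _ _ _ (@vec R d) (fun v => v ord0 j)).
  exact: vec_continuous.
exact: coord_continuous.
Qed.

Lemma vec_ge0 x j : 0 <= vec x ord0 j.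
Proof. by have [] : orthant R d (vec x) := set_mem (valP x). Qed.

Lemma norm1E x : norm1 x = \sum_j vec x ord0 j.
Proof. by apply: eq_bigr => j _; rewrite ger0_norm// vec_ge0. Qed.

(** On the orthant the 1-norm is the sum of the coordinates. *)
Lemma norm1_add x y : norm1 (addRstar x y) = norm1 x + norm1 y.
Proof.
by rewrite !norm1E -big_split; apply: eq_bigr => j _; rewrite /vec/= mxE.
Qed.

Lemma le_vec_norm1 x j : vec x ord0 j <= norm1 x.
Proof.
rewrite norm1E (bigD1 j)//= lerDl sumr_ge0// => i _; exact: vec_ge0.
Qed.

Lemma norm1_gt0 x : 0 < norm1 x.
Proof.
have [_ x0] : orthant R d (vec x) := set_mem (valP x).
rewrite lt_neqAle norm1E sumr_ge0 ?andbT => [|j _]; last exact: vec_ge0.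
rewrite eq_sym; apply: contra x0.
rewrite psumr_eq0 => [/allP x0|j _]; last first.
  exact: vec_ge0.
apply/eqP/rowP => j; rewrite mxE; apply/eqP.
by rewrite -[_ == _]/(true ==> _) x0// mem_index_enum.
Qed.

Lemma norm1_continuous : continuous (@norm1 R d).
Proof.
move=> x; rewrite (funext norm1E); move: x.
apply: (@continuous_big R _ +%R 0 xpredT) => [z|j _].
  exact: add_continuous.
exact: vec_coord_continuous.
Qed.

(** The image of the shell in R^d is closed and bounded. A cluster point there
    of the image of a filter has 1-norm at least a > 0, hence it is not the
    origin and comes back to the orthant, whose topology is induced. *)
Lemma compact_norm1 (a b : R) : 0 < a ->
  compact [set x : E | a <= norm1 x <= b].
Proof.
move=> a0.
pose S := [set v : 'rV[R]_d | (forall j, 0 <= v ord0 j) /\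
                              a <= \sum_j v ord0 j <= b].
have sum_cont : continuous (fun v : 'rV[R]_d => \sum_j v ord0 j).
  apply: (@continuous_big R _ +%R 0 xpredT) => [z|j _].
    exact: add_continuous.
  exact: coord_continuous.
have S_closed : closed S.
  have -> : S = (\bigcap_(j in setT) [set v : 'rV[R]_d | 0 <= v ord0 j]) `&`
      ((fun v : 'rV[R]_d => \sum_j v ord0 j) @^-1` `[a, b]).
    apply/seteqP; split=> v [v0 vab].
      by split=> [j _|]; [exact: v0|rewrite /= in_itv].
    by split=> [j|]; [exact: (v0 j I)|move: vab; rewrite /= in_itv].
  apply: closedI; last first.
    by move/continuous_closedP : sum_cont; apply; exact: itv_closed.
  apply: closed_bigI => j _.
  have /continuous_closedP := @coord_continuous R 1 d ord0 j.
  by move=> /(_ [set r | 0 <= r]); apply; exact: closed_ge.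
have S_bounded : bounded_set S.
  exists b; split; first exact: num_real.
  move=> M bM v [v0 /andP[_ vb]].
  have sum_ge0 : 0 <= \sum_j v ord0 j by exact: sumr_ge0.
  rewrite /= [leLHS]/Num.Def.normr/= mx_normrE; apply/bigmax_leP; split.
    by rewrite (le_trans sum_ge0)// (le_trans vb)// ltW.
  move=> [i j] _ /=; rewrite (ord1 i) ger0_norm//.
  apply: le_trans (ltW bM); apply: le_trans vb.
  by rewrite (bigD1 j)//= lerDl sumr_ge0.
have := bounded_closed_compact S_bounded S_closed => S_compact.
move=> F FF FS.
have FS' : F (vec @^-1` S).
  apply: filterS FS => x xab; split; first by move=> j; exact: vec_ge0.
  by rewrite -norm1E.
have [v [[v0 vab] vF]] := S_compact (vec @ F) _ FS'.
have v_orthant : v \in orthant R d.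
  apply/mem_set; split => //; apply/eqP => v_eq0.
  move: vab; rewrite v_eq0 big1 => [|j _]; last by rewrite mxE.
  by rewrite leNgt a0.
exists (exist _ v v_orthant); split; first by rewrite /= norm1E.
move=> A B FA [_ [[U oU <-] Uv] UB].
have FA' : F (vec @^-1` (vec @` A)) by apply: filterS FA => x Ax; exists x.
have [_ [[x Ax <-] Ux]] := vF _ U FA' (open_nbhs_nbhs (conj oU Uv)).
by exists x; split=> //; exact: UB.
Qed.

End space.

Section function_space.
Context {R : realType} {n : nat}.
Local Notation E := (Rstar R n.+1).
Implicit Types g : E -> R.

Lemma Cc_norm1 (a b : R) g : 0 < a -> continuous g ->
  (forall x, g x != 0 -> a <= norm1 x <= b) -> Cc g.
Proof.
move=> a0 g_cont g_supp; split => //.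
apply: (subclosed_compact _ (@compact_norm1 R n.+1 a b a0)).
  exact: closed_closure.
have /closure_id -> : closed [set x : E | a <= norm1 x <= b].
  have /continuous_closedP/(_ `[a, b]%classic) := @norm1_continuous R n.+1.
  have -> : @norm1 R n.+1 @^-1` `[a, b] = [set x : E | a <= norm1 x <= b].
    by apply/seteqP; split => x /=; rewrite in_itv.
  by apply; exact: itv_closed.
by apply: closureS => x /=; exact: g_supp.
Qed.

Lemma continuous_measurable_Rstar g : continuous g -> measurable_fun setT g.
Proof.
move=> g_cont; apply: (measurability _ (RGenOpens.measurableE R)).
move=> _ [_ [a [b ->] <-]]; rewrite setTI; apply: sub_sigma_algebra.
by move/continuousP : g_cont; apply; exact: interval_open.
Qed.

End function_space.

(** * Test functions that do not depend on time *)

Section time_constant.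
Context {R : realType}.

Lemma quot_cst (c s h : R) : quot (fun=> c) s h = 0.
Proof. by rewrite /quot subrr mulr0. Qed.

(** Arbitrarily small positive increments are admissible at every s >= 0. *)
Lemma dquot_filter_proper (s : R) : 0 <= s -> ProperFilter (dquot_filter s).
Proof.
move=> s0; apply: Build_ProperFilter_ex => /= A [e/= e0 eA].
exists (e / 2); apply: (eA (e / 2)) => /=.
- by rewrite sub0r normrN ger0_norm; lra.
- by rewrite gt_eqF//; lra.
- by lra.
Qed.

Lemma quot_cst_cvg (c s : R) : quot (fun=> c) s @ dquot_filter s --> (0 : R).
Proof.
have -> : quot (fun=> c) s = cst 0 by apply/funext => h; rewrite quot_cst.
apply: cvg_cst.
Qed.

Lemma deriv0_cst (c s : R) : 0 <= s -> Defs.deriv0 (fun=> c) s = 0.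
Proof.
move=> /dquot_filter_proper Fp; apply: (@cvg_lim _ (@Rhausdorff R) _ _ Fp).
exact: quot_cst_cvg.
Qed.

Lemma C1_cst (c : R) : C1 (fun=> c).
Proof.
split=> [s s0|]; first by apply/cvg_ex; exists 0; exact: quot_cst_cvg.
apply: (@subspace_eq_continuous _ _ _ (cst 0)) => [s|].
  by rewrite inE/= in_itv/= andbT => s0; rewrite [RHS]deriv0_cst.
by move=> s; exact: cvg_cst.
Qed.

End time_constant.

(** * The weight and the kernel *)

Section weight.
Context {R : realType} {d : nat}.
Context (beta : R) (gamma lambda : R * R).
Local Notation E := (Rstar R d).
Local Notation w := (@weight R d beta gamma lambda).
Implicit Types x y : E.

(** One of the two factors is always 1, and both are continuous: this removes
    the case distinction at |x| = 1. *)
Lemma weightE x : w x = Num.min (norm1 x) 1 `^ Num.min (- beta) (- lambda.1)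
  * Num.max (norm1 x) 1 `^ Num.max (gamma.1 + lambda.1) (gamma.2 + lambda.2).
Proof.
rewrite /weight; case: ifPn => [x1|]; last rewrite -ltNge => /ltW x1.
  by rewrite (min_l x1) (max_r x1) powR1 mulr1.
by rewrite (min_r x1) (max_l x1) powR1 mul1r.
Qed.

Lemma weight_gt0 x : 0 < w x.
Proof.
rewrite weightE mulr_gt0// powR_gt0//; have := norm1_gt0 x => x0.
  by rewrite lt_min x0 ltr01.
by rewrite lt_max x0.
Qed.

Lemma powR_continuous_pos (a r : R) : 0 < r ->
  {for r, continuous (fun z : R => z `^ a)}.
Proof.
move=> r0; apply: differentiable_continuous; apply/derivable1_diffP.
by apply: derivable_powR; rewrite in_itv/= r0.
Qed.

Lemma weight_continuous : continuous w.
Proof.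
move=> x; rewrite (funext weightE); have x0 := norm1_gt0 x.
apply: (@continuousM R E (fun x => Num.min (norm1 x) 1 `^ _)
  (fun x => Num.max (norm1 x) 1 `^ _)).
- apply: (@continuous_comp _ _ _ (fun x => Num.min (norm1 x) 1)
    (fun z : R => z `^ _)).
    apply: (@continuous_min R E norm1 (cst 1)); first exact: norm1_continuous.
    exact: cst_continuous.
  by apply: powR_continuous_pos; rewrite lt_min x0 ltr01.
- apply: (@continuous_comp _ _ _ (fun x => Num.max (norm1 x) 1)
    (fun z : R => z `^ _)).
    apply: (@continuous_max R E norm1 (cst 1)); first exact: norm1_continuous.
    exact: cst_continuous.
  by apply: powR_continuous_pos; rewrite lt_max x0.
Qed.

Lemma powR_le_weight_small x e : norm1 x <= 1 ->
  Num.min (- beta) (- lambda.1) <= e -> norm1 x `^ e <= w x.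
Proof. by move=> x1 be; rewrite /weight x1 ger_powR// norm1_gt0. Qed.

Lemma powR_le_weight_large x e : 1 <= norm1 x ->
  e <= Num.max (gamma.1 + lambda.1) (gamma.2 + lambda.2) -> norm1 x `^ e <= w x.
Proof.
move=> x1 eb; rewrite weightE min_r// max_l// powR1 mul1r.
exact: ler_powR.
Qed.

(** Its integrals against a solution are bounded on bounded time intervals: the
    first summand by the a priori bound on the weighted measures, the second
    one because mass does not increase. *)
Definition mweight x := w x + norm1 x.

Lemma mweight_gt0 x : 0 < mweight x.
Proof. by rewrite addr_gt0 ?weight_gt0 ?norm1_gt0. Qed.

Lemma weight_le_mweight x : w x <= mweight x.
Proof. by rewrite lerDl ltW// norm1_gt0. Qed.

Lemma norm1_le_mweight x : norm1 x <= mweight x.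
Proof. by rewrite lerDr ltW// weight_gt0. Qed.

Lemma mweight_continuous : continuous mweight.
Proof.
move=> x; apply: (@continuousD R R^o E w norm1).
  exact: weight_continuous.
exact: norm1_continuous.
Qed.

Context (exp2 : - lambda.2 <= gamma.2 + lambda.2 /\ gamma.2 + lambda.2 <= 1).
Context (gamma2_le1 : gamma.2 <= 1).

(** For lambda.2 >= 0 the power of s is at most 1 and the exponent of r at most
    1. For lambda.2 < 0 the power of s is at most the same power of r, and
    what remains is r `^ gamma.2; this is where gamma.2 <= 1 enters. *)
Lemma powR_large_le (r s : R) : 1 <= s -> s <= r ->
  r `^ (gamma.2 + lambda.2) * s `^ (- lambda.2) * s <= r * s.
Proof.
move=> s1 sr; have r1 := le_trans s1 sr.
have s0 : 0 < s by exact: lt_le_trans s1.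
have r0 : 0 < r by exact: lt_le_trans r1.
rewrite ler_pM2r//; have [l0|l0] := leP 0 lambda.2.
  rewrite -[leRHS]mulr1; apply: ler_pM; rewrite ?powR_ge0//.
    by rewrite ler1_powR//; case: exp2.
  by rewrite -(powRr0 s) ler_powR// oppr_le0.
apply: (@le_trans _ _ (r `^ (gamma.2 + lambda.2) * r `^ (- lambda.2))).
  rewrite ler_wpM2l ?powR_ge0// ge0_ler_powR// ?nnegrE ?ltW//.
  by rewrite oppr_gt0.
rewrite -powRD ?(gt_eqF r0) ?implybT//.
by rewrite addrK ler1_powR.
Qed.

Context (K : E -> E -> R) (c2 : R).
Context (c2_gt0 : 0 < c2).
Context (K_le : kernel_bound K c2 beta gamma lambda).

(** An increment of a Lipschitz test function gains a factor min(|x|, |y|), and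
    with this gain the kernel is dominated by a product of integrable
    functions: if |y| <= 1 the weights control the powers of |x| and |y|, and
    if both are at least 1 then so does |x| |y|. *)
Lemma kernel_mul_norm1_le x y : norm1 y <= norm1 x ->
  K x y * norm1 y <= c2 * (mweight x * mweight y).
Proof.
move=> yx; have [K11 K12 K22] := K_le yx.
have x0 := norm1_gt0 x; have y0 := norm1_gt0 y.
have reduce (a b : R) : K x y <= c2 * (a * b) -> 0 <= a -> 0 <= b ->
    a * (b * norm1 y) <= mweight x * mweight y ->
    K x y * norm1 y <= c2 * (mweight x * mweight y).
  move=> Kab a0 b0 ab; apply: (@le_trans _ _ (c2 * (a * b) * norm1 y)).
    by rewrite ler_wpM2r// ltW.
  by rewrite -mulrA ler_wpM2l ?(ltW c2_gt0)// -mulrA.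
have small_y e : norm1 y <= 1 -> Num.min (- beta) (- lambda.1) <= e ->
    norm1 y `^ e * norm1 y <= mweight y.
  move=> y1 be; apply: le_trans (weight_le_mweight _).
  apply: le_trans (powR_le_weight_small y1 be).
  by rewrite ler_piMr// powR_ge0.
have [x1|/ltW x1] := leP (norm1 x) 1.
  have y1 := le_trans yx x1.
  apply: (reduce _ _ (K11 x1 y1)); rewrite ?powR_ge0//.
  apply: ler_pM; rewrite ?mulr_ge0 ?powR_ge0 ?(ltW y0)//.
    apply: le_trans (weight_le_mweight _).
    by apply: powR_le_weight_small => //; rewrite ge_min lexx.
  by apply: small_y => //; rewrite ge_min lexx.
have [y1|/ltW y1] := leP (norm1 y) 1.
  apply: (reduce _ _ (K12 x1 y1)); rewrite ?powR_ge0//.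
  apply: ler_pM; rewrite ?mulr_ge0 ?powR_ge0 ?(ltW y0)//.
    apply: le_trans (weight_le_mweight _).
    by apply: powR_le_weight_large => //; rewrite le_max lexx.
  by apply: small_y => //; rewrite ge_min lexx orbT.
apply: (reduce _ _ (K22 x1 y1)); rewrite ?powR_ge0// mulrA.
apply: (le_trans (powR_large_le y1 yx)).
by apply: ler_pM; rewrite ?norm1_le_mweight// ltW.
Qed.

End weight.

(** * Truncated coordinates as test functions *)

Section test_function.
Context {R : realType} {n : nat}.
Local Notation E := (Rstar R n.+1).
Implicit Types (x y : E) (p s : R).

Definition radial_cutoff p x : R := cutoff p (norm1 x).

Lemma radial_cutoff_continuous p : continuous (radial_cutoff p).
Proof.
move=> x; apply: (@continuous_comp _ _ _ norm1 (cutoff p)).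
  exact: norm1_continuous.
exact: cutoff_continuous.
Qed.

Lemma radial_cutoff_mul_Cc p (g : E -> R) : 0 < p -> continuous g ->
  Cc (fun x => g x * radial_cutoff p x).
Proof.
move=> p0 g_cont; apply: (@Cc_norm1 R n p^-1 (2 * p)).
  by rewrite invr_gt0.
  move=> x; apply: (@continuousM R E g (radial_cutoff p)); first exact: g_cont.
  exact: radial_cutoff_continuous.
by move=> x; rewrite mulf_eq0 negb_or => /andP[_]; exact: cutoff_supp.
Qed.

Definition cut_coord j p x (_ : R) : R := vec x ord0 j * radial_cutoff p x.

Lemma cut_coord_test j p : 0 < p -> test_function (cut_coord j p).
Proof.
move=> p0; split=> [x|t _]; first exact: C1_cst.
by apply: radial_cutoff_mul_Cc => //; exact: vec_coord_continuous.
Qed.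

Lemma coag_cut_coordC j p s x y :
  coag (cut_coord j p) s x y = coag (cut_coord j p) s y x.
Proof.
rewrite /coag addrAC; congr (cut_coord j p _ s - _ - _).
by apply: val_inj; exact: addrC.
Qed.

(** Coordinates are additive, so that the coagulation increment of a truncated
    coordinate only involves increments of the cutoff. *)
Lemma coag_cut_coord_eq j p s x y :
  coag (cut_coord j p) s x y =
  vec x ord0 j * (cutoff p (norm1 x + norm1 y) - cutoff p (norm1 x)) +
  vec y ord0 j * (cutoff p (norm1 y + norm1 x) - cutoff p (norm1 y)).
Proof.
rewrite /coag /cut_coord /radial_cutoff norm1_add [norm1 y + _]addrC.
by rewrite {1}/vec /= mxE; ring.
Qed.

(** For the larger argument x the increment of the cutoff is at most 4 |y| / |x|
    by [cutoff_increment]; for the smaller one y it is at most 1. *)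
Lemma coag_cut_coord_le j p s x y : 0 < p -> norm1 y <= norm1 x ->
  `|coag (cut_coord j p) s x y| <= 5 * norm1 y.
Proof.
move=> p0 yx; rewrite coag_cut_coord_eq; apply: (le_trans (ler_normD _ _)).
rewrite !normrM !(ger0_norm (vec_ge0 _ _)).
have x0 := ltW (norm1_gt0 x); have y0 := ltW (norm1_gt0 y).
have -> : 5 * norm1 y = 4 * norm1 y + norm1 y by ring.
apply: lerD.
  apply: le_trans (cutoff_increment p0 x0 y0).
  by rewrite ler_wpM2r// le_vec_norm1.
apply: (@le_trans _ _ (vec y ord0 j * 1)); last by rewrite mulr1 le_vec_norm1.
rewrite ler_wpM2l ?vec_ge0// ler_norml.
move: (cutoff_ge0 p (norm1 y + norm1 x)) (cutoff_le1 p (norm1 y + norm1 x)).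
by move: (cutoff_ge0 p (norm1 y)) (cutoff_le1 p (norm1 y)); lra.
Qed.

(** If x and y are in the support of the cutoff at level p, then |x|, |y| and
    |x + y| are all between 1/p and 4p, where the cutoff at level 4p is 1. *)
Lemma coag_cut_coord_eq0 j p s x y : 0 < p ->
  radial_cutoff p x != 0 -> radial_cutoff p y != 0 ->
  coag (cut_coord j (4 * p)) s x y = 0.
Proof.
move=> p0 /(cutoff_supp p0)/andP[x1 x2] /(cutoff_supp p0)/andP[y1 y2].
have pV : 2 / (4 * p) = p^-1 / 2 by field; rewrite gt_eqF.
have pV0 : 0 < p^-1 by rewrite invr_gt0.
rewrite coag_cut_coord_eq !cutoff_eq1 ?subrr ?mulr0 ?addr0 ?mulr_gt0//;
  by rewrite pV; apply/andP; split; lra.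
Qed.

End test_function.

Section coagulation_bound.
Context {R : realType} {n : nat}.
Local Notation E := (Rstar R n.+1).
Context (K : E -> E -> R) (c2 beta : R) (gamma lambda : R * R).
Context (K_ge0 : forall x y, 0 <= K x y).
Context (K_sym : forall x y, K x y = K y x).
Context (c2_gt0 : 0 < c2).
Context (exp2 : - lambda.2 <= gamma.2 + lambda.2 /\ gamma.2 + lambda.2 <= 1).
Context (gamma2_le1 : gamma.2 <= 1).
Context (K_le : kernel_bound K c2 beta gamma lambda).
Local Notation W := (mweight beta gamma lambda).

Lemma kernel_coag_le_mweight j p s x y : 0 < p ->
  `|K x y * coag (cut_coord j p) s x y| <= 5 * c2 * (W x * W y).
Proof.
move=> p0; wlog yx : x y / norm1 y <= norm1 x.
  move=> H; have [/H//|/ltW/H] := leP (norm1 y) (norm1 x).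
  by rewrite coag_cut_coordC K_sym [W x * _]mulrC.
rewrite normrM (ger0_norm (K_ge0 _ _)).
apply: (@le_trans _ _ (K x y * (5 * norm1 y))).
  by rewrite ler_wpM2l// coag_cut_coord_le.
rewrite mulrCA -mulrA ler_wpM2l//.
exact: (kernel_mul_norm1_le exp2 gamma2_le1 c2_gt0 K_le yx).
Qed.

(** By [coag_cut_coord_eq0] the increment vanishes unless one of the two
    cutoffs is 0, in which case the last factor is at least 1. The bound has
    separated variables, as [double_integral_le] requires. *)
Lemma kernel_coag_le j p s x y : 0 < p ->
  `|K x y * coag (cut_coord j (4 * p)) s x y| <=
  5 * c2 * (W x * W y) * ((1 - radial_cutoff p x) + (1 - radial_cutoff p y)).
Proof.
move=> p0; have W0 : 0 <= 5 * c2 * (W x * W y).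
  by rewrite !mulr_ge0 ?(ltW c2_gt0) ?(ltW (mweight_gt0 _ _ _ _)).
have x1 : radial_cutoff p x <= 1 := cutoff_le1 _ _.
have y1 : radial_cutoff p y <= 1 := cutoff_le1 _ _.
have le1 : `|K x y * coag (cut_coord j (4 * p)) s x y| <= 5 * c2 * (W x * W y).
  by apply: kernel_coag_le_mweight; rewrite mulr_gt0.
have [bx|bx] := eqVneq (radial_cutoff p x) 0.
  by apply: (le_trans le1); rewrite ler_peMr// bx; lra.
have [b_y|b_y] := eqVneq (radial_cutoff p y) 0.
  by apply: (le_trans le1); rewrite ler_peMr// b_y; lra.
by rewrite coag_cut_coord_eq0// mulr0 normr0 mulr_ge0//; lra.
Qed.

End coagulation_bound.

(** * Removing the truncation *)

Section truncation_limits.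
Context {R : realType} {n : nat}.
Local Notation E := (Rstar R n.+1).
Context (beta : R) (gamma lambda : R * R).
Local Notation w := (weight beta gamma lambda).
Local Notation W := (mweight beta gamma lambda).
Implicit Types (x : E) (mu : {measure set E -> \bar R}).

Lemma radial_cutoff_cvg (p_ : nat -> R) x : p_ @ \oo --> +oo ->
  (fun m => radial_cutoff (p_ m) x) @ \oo --> (1 : R).
Proof.
move=> /cvgryPge p_oo; have x0 := norm1_gt0 x.
apply: cvg_near_cst; near=> m.
have p1 : 1 <= p_ m by near: m; exact: p_oo.
have px : norm1 x <= p_ m by near: m; exact: p_oo.
have p2 : 2 / norm1 x <= p_ m by near: m; exact: p_oo.
have p0 : 0 < p_ m by exact: lt_le_trans p1.
rewrite /radial_cutoff cutoff_eq1// px andbT.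
by move: p2; rewrite ler_pdivrMr// ler_pdivrMr// mulrC.
Unshelve. all: by end_near. Qed.

Lemma ge_natr_cvg_pinfty (p_ : nat -> R) : (forall m, m%:R <= p_ m) ->
  p_ @ \oo --> +oo.
Proof.
move=> p_ge; apply/cvgryPge => A; near=> m; apply: le_trans (p_ge m).
by near: m; exact: nbhs_infty_ger.
Unshelve. all: by end_near. Qed.

Lemma radial_cutoff_ge0 p x : 0 <= radial_cutoff p x.
Proof. exact: cutoff_ge0. Qed.

Lemma radial_cutoff_le1 p x : radial_cutoff p x <= 1.
Proof. exact: cutoff_le1. Qed.

Lemma radial_cutoff_measurable p :
  measurable_fun setT (radial_cutoff p : E -> R).
Proof.
by apply: continuous_measurable_Rstar; exact: radial_cutoff_continuous.
Qed.

Lemma mweight_measurable : measurable_fun setT (W : E -> R).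
Proof. by apply: continuous_measurable_Rstar; exact: mweight_continuous. Qed.

Lemma ge0_integrable mu (g : E -> R) : measurable_fun setT g ->
  (forall x, 0 <= g x) -> (\int[mu]_x (g x)%:E < +oo)%E ->
  mu.-integrable setT (EFin \o g).
Proof.
move=> mg g0 goo; apply/integrableP; split; first exact/measurable_EFinP.
rewrite (eq_integral (EFin \o g))// => x _ /=.
by rewrite ger0_norm.
Qed.

(** The part of the weighted mass that escapes the truncation at level p, close
    to the origin or to infinity. *)
Definition defect mu p : R := \int[mu]_x (W x * (1 - radial_cutoff p x)).

Lemma integrable_defect mu p : mu.-integrable setT (EFin \o W) ->
  mu.-integrable setT (EFin \o (fun x => W x * (1 - radial_cutoff p x))).
Proof.
apply: le_integrable => //.
  apply/measurable_EFinP/measurable_funM; first exact: mweight_measurable.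
  by apply: measurable_funB => //; exact: radial_cutoff_measurable.
move=> x _ /=; rewrite lee_fin normrM ler_piMr//.
rewrite ger0_norm ?subr_ge0 ?radial_cutoff_le1//.
by have := radial_cutoff_ge0 p x; lra.
Qed.

Lemma defect_ge0 mu p : 0 <= defect mu p.
Proof.
apply: Rintegral_ge0 => x _.
by rewrite mulr_ge0 ?subr_ge0 ?radial_cutoff_le1// ltW// mweight_gt0.
Qed.

Lemma defect_le_mass mu p : mu.-integrable setT (EFin \o W) ->
  defect mu p <= \int[mu]_x W x.
Proof.
move=> iW; apply: le_Rintegral => //; first exact: integrable_defect.
move=> x _; rewrite ler_piMr ?(ltW (mweight_gt0 _ _ _ _))//.
by have := radial_cutoff_ge0 p x; lra.
Qed.

Lemma defect_cvg0 mu (p_ : nat -> R) : p_ @ \oo --> +oo ->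
  mu.-integrable setT (EFin \o W) ->
  (fun m => defect mu (p_ m)) @ \oo --> (0 : R).
Proof.
move=> p_oo iW.
have <- : \int[mu]_x (cst 0 x : R) = 0 by rewrite /Rintegral/= integral0.
apply: (@cvg_Rintegral _ _ _ mu setT _ (cst 0) W) => //.
- move=> m; apply: measurable_funM; first exact: mweight_measurable.
  by apply: measurable_funB => //; exact: radial_cutoff_measurable.
- move=> x _; rewrite [cst _ _](_ : _ = W x * (1 - 1)); last first.
    by rewrite subrr mulr0.
  apply: cvgMr; apply: cvgB; first exact: cvg_cst.
  exact: radial_cutoff_cvg.
- move=> m x _; rewrite ger0_norm ?mulr_ge0 ?(ltW (mweight_gt0 _ _ _ _))//.
    rewrite ler_piMr ?(ltW (mweight_gt0 _ _ _ _))//.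
    by have := radial_cutoff_ge0 (p_ m) x; lra.
  by rewrite subr_ge0 radial_cutoff_le1.
Qed.

Lemma defectE mu p : mu.-integrable setT (EFin \o W) ->
  defect mu p = \int[mu]_x W x - \int[mu]_x (W x * radial_cutoff p x).
Proof.
move=> iW; rewrite -RintegralB//.
  by apply: eq_Rintegral => x _; rewrite mulrBr mulr1.
apply: le_integrable iW => //.
  apply/measurable_EFinP/measurable_funM; first exact: mweight_measurable.
  exact: radial_cutoff_measurable.
move=> x _ /=; rewrite lee_fin normrM ler_piMr//.
by rewrite ger0_norm ?radial_cutoff_ge0 ?radial_cutoff_le1.
Qed.

Lemma cut_coord_cvg mu (p_ : nat -> R) j (t : R) : p_ @ \oo --> +oo ->
  (\int[mu]_x (norm1 x)%:E < +oo)%E ->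
  (fun m => \int[mu]_x cut_coord j (p_ m) x t) @ \oo -->
  \int[mu]_x vec x ord0 j.
Proof.
move=> p_oo norm1_oo.
have mvec : measurable_fun setT (fun x => vec x ord0 j).
  by apply: continuous_measurable_Rstar; exact: vec_coord_continuous.
apply: (@cvg_Rintegral _ _ _ mu setT _ _ norm1) => //.
- by move=> m; apply: measurable_funM => //; exact: radial_cutoff_measurable.
- move=> x _; rewrite -[X in _ --> X]mulr1.
  by apply: cvgMr; exact: radial_cutoff_cvg.
- apply: ge0_integrable => //.
    by apply: continuous_measurable_Rstar; exact: norm1_continuous.
  by move=> x; rewrite ltW// norm1_gt0.
- move=> m x _; rewrite ger0_norm; last first.
    by apply: mulr_ge0; [exact: vec_ge0|exact: radial_cutoff_ge0].
  apply: le_trans (le_vec_norm1 x j).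
  by rewrite ler_piMr ?vec_ge0 ?radial_cutoff_le1.
Qed.

Context (f : R -> {measure set E -> \bar R}).
Context (f_cont : weakstar_continuous w f).

(** W times a cutoff is w times a continuous function of compact support, so
    that weak-* continuity of the weighted measures applies. *)
Lemma radial_cutoff_mass_measurable (p t : R) : 0 < p ->
  measurable_fun `[0%R, t] (fun s => \int[f s]_x (W x * radial_cutoff p x)).
Proof.
move=> p0; apply: subspace_continuous_measurable_fun => //.
have sub0t : `[0, t]%classic `<=` `[0, +oo[%classic.
  by move=> s /=; rewrite !in_itv/= andbT => /andP[].
apply: (continuous_subspaceW sub0t).
have [_ /(_ (fun x => W x / w x * radial_cutoff p x))] := f_cont.
have -> : (fun s => \int[f s]_x (W x / w x * radial_cutoff p x * w x)) =
    (fun s => \int[f s]_x (W x * radial_cutoff p x)).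
  apply/funext => s; apply: eq_Rintegral => x _.
  by rewrite mulrAC divfK// gt_eqF// weight_gt0.
apply; apply: subset_closure; apply: radial_cutoff_mul_Cc => // x.
apply: (@continuousM R E W (fun x => (w x)^-1)).
  exact: mweight_continuous.
apply: (@continuousV R E w); last exact: weight_continuous.
by rewrite gt_eqF// weight_gt0.
Qed.

(** The total weighted mass is not known to be continuous in time, but it is a
    limit of the truncated ones, which are. *)
Lemma defect_measurable (p t : R) : 0 < p ->
  (forall s, 0 <= s <= t -> (f s).-integrable setT (EFin \o W)) ->
  measurable_fun `[0%R, t] (fun s => defect (f s) p).
Proof.
move=> p0 iW.
have p_oo : (fun m => m.+1%:R : R) @ \oo --> +oo.
  by apply: ge_natr_cvg_pinfty => m; rewrite ler_nat.
have mmass : measurable_fun `[0, t] (fun s => \int[f s]_x W x).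
  apply: (measurable_fun_cvg
    (h := fun m s => \int[f s]_x (W x * radial_cutoff m.+1%:R x))).
    by move=> m; exact: radial_cutoff_mass_measurable.
  move=> s; rewrite /= in_itv/= => /iW iWs.
  have -> : (fun m => \int[f s]_x (W x * radial_cutoff m.+1%:R x)) =
      (fun m => \int[f s]_x W x - defect (f s) m.+1%:R).
    by apply/funext => m; rewrite defectE// opprB addrC subrK.
  rewrite -[X in _ --> X]subr0; apply: cvgB; first exact: cvg_cst.
  exact: defect_cvg0.
apply: (eq_measurable_fun
    (fun s => \int[f s]_x W x - \int[f s]_x (W x * radial_cutoff p x))).
  by move=> s; rewrite inE/= in_itv/= => /iW/defectE ->.
by apply: measurable_funB => //; exact: radial_cutoff_mass_measurable.
Qed.

End truncation_limits.

(** * Conservation of mass *)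

Section conservation.
Context {R : realType} {n : nat}.
Local Notation E := (Rstar R n.+1).
Implicit Types (mu : {measure set E -> \bar R}).

Lemma integral_norm1E mu :
  (\int[mu]_x (norm1 x)%:E = \sum_j moment mu ord0 j)%E.
Proof.
under eq_integral do rewrite norm1E -sumEFin.
rewrite ge0_integral_sum//.
- by apply: eq_bigr => j _; rewrite mxE.
- move=> j; apply/measurable_EFinP; apply: continuous_measurable_Rstar.
  exact: vec_coord_continuous.
- by move=> j x _; rewrite lee_fin vec_ge0.
Qed.

Lemma integral_mweight mu beta gamma lambda :
  (\int[mu]_x (mweight beta gamma lambda x)%:E =
   \int[mu]_x (weight beta gamma lambda x)%:E + \int[mu]_x (norm1 x)%:E)%E.
Proof.
under eq_integral do rewrite EFinD.
rewrite ge0_integralD//.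
- by move=> x _; rewrite lee_fin ltW// weight_gt0.
- apply/measurable_EFinP; apply: continuous_measurable_Rstar.
  exact: weight_continuous.
- by move=> x _; rewrite lee_fin ltW// norm1_gt0.
- apply/measurable_EFinP; apply: continuous_measurable_Rstar.
  exact: norm1_continuous.
Qed.

End conservation.

(* The dimension is d = n.+1. *)
Theorem theorem1p3 (R : realType) (n : nat)
    (K : Rstar R n.+1 -> Rstar R n.+1 -> R)
    (K_ge0 : forall x y, 0 <= K x y)
    (K_cont : continuous (fun z : Rstar R n.+1 * Rstar R n.+1 => K z.1 z.2))
    (K_sym : forall x y, K x y = K y x)
    (c2 beta : R) (gamma lambda : R * R)
    (c2_gt0 : 0 < c2)
    (exp1 : - lambda.1 <= gamma.1 + lambda.1 /\ gamma.1 + lambda.1 <= 1)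
    (exp2 : - lambda.2 <= gamma.2 + lambda.2 /\ gamma.2 + lambda.2 <= 1)
    (K_le : kernel_bound K c2 beta gamma lambda)
    (f0 : {measure set (Rstar R n.+1) -> \bar R})
    (f0_radon : radon f0)
    (f0_moments : (\int[f0]_x (norm1 x)%:E
                   + \int[f0]_x (weight beta gamma lambda x)%:E < +oo)%E)
    (f : R -> {measure set (Rstar R n.+1) -> \bar R})
    (f_sol : weak_solution K (weight beta gamma lambda) f0 f)
    (gamma2_le1 : gamma.2 <= 1) :
  forall t : R, 0 <= t -> moment (f t) = moment f0.
Proof.
case: f_sol => _ _ f_cont f_sup f_mom f_weak t t0.
set W := mweight beta gamma lambda : Rstar R n.+1 -> R.
have W0 x : 0 <= W x by rewrite ltW// mweight_gt0.
have norm1_f0 : (\int[f0]_x (norm1 x)%:E < +oo)%E.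
  apply: le_lt_trans f0_moments; apply: leeDl; apply: integral_ge0 => x _.
  by rewrite lee_fin ltW// weight_gt0.
have norm1_f s : 0 <= s ->
    (\int[f s]_x (norm1 x)%:E <= \int[f0]_x (norm1 x)%:E)%E.
  by move=> s0; rewrite !integral_norm1E; apply: lee_sum => j _; exact: f_mom.
have norm1_f_oo s : 0 <= s -> (\int[f s]_x (norm1 x)%:E < +oo)%E.
  by move=> /norm1_f /le_lt_trans; exact.
have [C mass_le] : exists C : R, forall s, 0 <= s <= t ->
    (\int[f s]_x (W x)%:E <= C%:E)%E.
  move: (f_sup t t0); set S := ereal_sup _ => S_oo.
  have S0 : (0 <= S)%E.
    have S0 : ((\int[f 0%R]_x (weight beta gamma lambda x)%:E) <= S)%E.
      by apply: ereal_sup_ubound; exists 0 => //=; rewrite in_itv/= lexx.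
    apply: le_trans S0; apply: integral_ge0 => x _.
    by rewrite lee_fin ltW// weight_gt0.
  have N0 : (0 <= \int[f0]_x (norm1 x)%:E)%E.
    by apply: integral_ge0 => x _; rewrite lee_fin ltW// norm1_gt0.
  exists (fine S + fine (\int[f0]_x (norm1 x)%:E)%E) => s /andP[s0 st].
  rewrite EFinD !fineK ?ge0_fin_numE// integral_mweight; apply: leeD.
    by apply: ereal_sup_ubound; exists s => //=; rewrite in_itv/= s0.
  exact: norm1_f.
have iW s : 0 <= s <= t -> (f s).-integrable setT (EFin \o W).
  move=> st; apply: ge0_integrable => //; first exact: mweight_measurable.
  by apply: le_lt_trans (mass_le s st) _; rewrite ltry.
have massC s : 0 <= s <= t -> \int[f s]_x W x <= C.
  by move=> st; rewrite -lee_fin EFin_Rintegral; [exact: mass_le| |exact: iW].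
have C0 : 0 <= C.
  by apply: le_trans (massC 0 _); rewrite ?lexx// Rintegral_ge0.
pose dft s m := defect beta gamma lambda (f s) m.+1%:R.
pose k := 2 * (5 * c2) * C.
have k0 : 0 <= k by rewrite !mulr_ge0// ltW.
have dft_le s m : 0 <= s <= t -> k * dft s m <= k * C.
  move=> st; rewrite ler_wpM2l//; apply: le_trans (massC s st).
  by apply: defect_le_mass; exact: iW.
have p_oo : (fun m => m.+1%:R : R) @ \oo --> +oo.
  by apply: ge_natr_cvg_pinfty => m; rewrite ler_nat.
have k_dft s m : s \in `[0, t]%R -> `|k * dft s m| <= k * C.
  by rewrite in_itv/= => st; rewrite ger0_norm ?dft_le// mulr_ge0// defect_ge0.
have m_dft m : measurable_fun `[0, t] (fun s => k * dft s m).
  apply: measurable_funM => //; apply: defect_measurable => //.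
have ikC : lebesgue_measure.-integrable `[0, t] (EFin \o cst (k * C)).
  apply: continuous_compact_integrable; first exact: segment_compact.
  by apply: continuous_subspaceT; exact: cst_continuous.
have i_dft m : lebesgue_measure.-integrable `[0, t]
    (EFin \o (fun s => k * dft s m)).
  apply: le_integrable ikC => //; first by apply/measurable_EFinP; exact: m_dft.
  move=> s st /=; rewrite lee_fin [leRHS]ger0_norm//; last first.
    exact: mulr_ge0 k0 C0.
  exact: k_dft.
have dft_cvg0 : (fun m => \int[lebesgue_measure]_(s in `[0, t]) (k * dft s m))
    @ \oo --> (0 : R).
  have int0 : \int[lebesgue_measure]_(s in `[0, t]) (cst 0 s : R) = 0.
    by rewrite /Rintegral/= integral0.
  rewrite -[X in _ --> X]int0.
  have dft_pt s : s \in `[0, t]%R -> (fun m => k * dft s m) @ \oo --> cst 0 s.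
    rewrite in_itv/= => st; rewrite -[X in _ --> X](mulr0 k); apply: cvgMr.
    by apply: defect_cvg0 => //; exact: iW.
  by apply: (@cvg_Rintegral _ _ _ lebesgue_measure `[0, t]%classic
    (fun m s => k * dft s m) (cst 0) (cst (k * C))) => // m s; exact: k_dft.
(* The weak formulation for the j-th coordinate cut at level 4 (m + 1); the
   factor 4 is the one of [coag_cut_coord_eq0], and k = 2 (5 c2) C combines
   [kernel_coag_le], [double_integral_le] and the bound C. *)
have growth j m : `|\int[f t]_x cut_coord j (4 * m.+1%:R) x t -
    \int[f0]_x cut_coord j (4 * m.+1%:R) x 0| <=
    2^-1 * \int[lebesgue_measure]_(s in `[0, t]) (k * dft s m).
  have p0 : (0 : R) < m.+1%:R by rewrite ltr0n.
  pose phi := cut_coord j (4 * m.+1%:R) : Rstar R n.+1 -> R -> R.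
  have phi_test : test_function phi by apply: cut_coord_test; rewrite mulr_gt0.
  have phi' x s : 0 <= s -> Defs.deriv0 (phi x) s = 0 by exact: deriv0_cst.
  have coag_le s : 0 <= s <= t ->
      (\int[f s]_x \int[f s]_y (`|K x y * coag phi s x y|)%R%:E <=
        (k * dft s m)%:E)%E /\
      `|\int[f s]_x \int[f s]_y (K x y * coag phi s x y)| <= k * dft s m.
    move=> st.
    have [] := @double_integral_le _ _ _ (f s)
      (fun x y => K x y * coag phi s x y) (5 * c2) W
      (fun x => 1 - radial_cutoff m.+1%:R x) _ W0 _ (iW s st)
      (integrable_defect m.+1%:R (iW s st)) _.
    - by rewrite mulr_ge0// ltW.
    - by move=> x; rewrite subr_ge0; exact: radial_cutoff_le1.
    - by move=> x y; exact: kernel_coag_le.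
    have : 2 * (5 * c2) * (\int[f s]_x W x) *
        (\int[f s]_x (W x * (1 - radial_cutoff m.+1%:R x))) <= k * dft s m.
      rewrite ler_wpM2r ?defect_ge0// ler_wpM2l ?massC//.
      by rewrite !mulr_ge0// ltW.
    move=> le_k le1 le2; split; last exact: le_trans le_k.
    by apply: (le_trans le1); rewrite lee_fin.
  have phi_int : weak_integrable K f phi t.
    split.
      rewrite (_ : integral _ _ _ = 0%E)//.
      apply: integral0_eq => s; rewrite /= in_itv/= => /andP[s0 _].
      by apply: integral0_eq => x _; rewrite phi' // normr0.
    apply: (@le_lt_trans _ _ (\int[lebesgue_measure]_(s in `[0%R, t])
        (k * dft s m)%:E)%E).
      apply: ge0_le_integral_nonmeas => s; rewrite /= in_itv/= => st.
        apply: integral_ge0 => x _; apply: integral_ge0 => y _.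
        by rewrite lee_fin.
      by have [] := coag_le s st.
    by rewrite -EFin_Rintegral// ltry.
  rewrite (f_weak t phi t0 phi_test phi_int).
  rewrite [X in X + _](_ : _ = 0); last first.
    rewrite /Rintegral integral0_eq// => s; rewrite /= in_itv/= => /andP[s0 _].
    by rewrite integral0_eq// => x _; rewrite phi'.
  rewrite add0r normrM (ger0_norm (_ : 0 <= 2^-1)) ?invr_ge0// ler_wpM2l//.
  apply: normr_Rintegral_le => [s|]; last by rewrite -EFin_Rintegral// ltry.
  by rewrite /= in_itv/= => /coag_le[].
have vec_eq j : \int[f t]_x vec x ord0 j = \int[f0]_x vec x ord0 j.
  have p4_oo : (fun m => 4 * m.+1%:R : R) @ \oo --> +oo.
    apply: ge_natr_cvg_pinfty => m.
    by rewrite -natrM ler_nat (leq_trans (leqnSn m))// leq_pmull.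
  have lim_t := @cut_coord_cvg _ _ (f t) _ j t p4_oo (norm1_f_oo t t0).
  have lim_0 := @cut_coord_cvg _ _ f0 _ j 0 p4_oo norm1_f0.
  have lim_d : (fun m => `|\int[f t]_x cut_coord j (4 * m.+1%:R) x t -
      \int[f0]_x cut_coord j (4 * m.+1%:R) x 0|) @ \oo -->
      `|\int[f t]_x vec x ord0 j - \int[f0]_x vec x ord0 j|.
    by apply: cvg_norm; exact: cvgB.
  have lim_r : (fun m => 2^-1 *
      \int[lebesgue_measure]_(s in `[0, t]) (k * dft s m)) @ \oo -->
      (2^-1 * 0 : R).
    exact: cvgMr.
  apply/eqP; rewrite -subr_eq0 -normr_le0 -(mulr0 2^-1).
  by apply: (ler_cvg_to lim_d lim_r); apply: nearW => m; exact: growth.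
apply/rowP => j; rewrite !mxE.
have ivec (mu : {measure set (Rstar R n.+1) -> \bar R}) :
    (\int[mu]_x (norm1 x)%:E < +oo)%E ->
    mu.-integrable setT (fun x : Rstar R n.+1 => (vec x ord0 j)%:E).
  move=> norm1_mu; apply: (@ge0_integrable _ _ _ (fun x => vec x ord0 j)).
  - by apply: continuous_measurable_Rstar; exact: vec_coord_continuous.
  - by move=> x; exact: vec_ge0.
  - apply: le_lt_trans norm1_mu; apply: ge0_le_integral_nonmeas => x _.
      by rewrite lee_fin vec_ge0.
    by rewrite lee_fin le_vec_norm1.
rewrite -(EFin_Rintegral measurableT (ivec _ (norm1_f_oo t t0))).
by rewrite -(EFin_Rintegral measurableT (ivec _ norm1_f0)) vec_eq.
Qed.
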